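(* The theories $\mathrm{ECBDA}$ and $\mathrm{ECDA}$ are $\aleph_0$-categorical, that is, each of them has a unique countable model up to isomorphism.
   Context: A De Morgan algebra is a bounded distributive lattice $(D;+,\cdot,0,1)$ ($+$ join, $\cdot$ meet) with a unary operation $\bar{\ }$ satisfying $\bar{\bar x}=x$ and $\overline{x+y}=\bar x\cdot\bar y$. It is complemented if $\forall x\exists y\,(xy=0\wedge x+y=1)$. A Boole-De Morgan algebra is an algebra $(A;+,\cdot,',\bar{\ },0,1)$ such that $(A;+,\cdot,',0,1)$ is a Boolean algebra (with complement $'$) and $(A;+,\cdot,\bar{\ },0,1)$ is a De Morgan algebra. Convention: $0\neq1$. Put $x^*:=(\bar x)'=\overline{(x')}$ (the two agree in every Boole-De Morgan algebra). Consistency: for $\sigma\in S_n$, a triple $(I_1,I_2,I_3)$ of subsets of $\{1,\dots,n\}$ is $\sigma$-consistent if $\sigma(I_2)=I_2$, $\sigma(I_3)=I_3$, and $(I_1\cap I_2\cap I_3)\cap\sigma(I_1\cap I_2\cap I_3)=\emptyset$. Theory $\mathrm{ECBDA}$: for $y=(y_1,\dots,y_n)$ and $I_1,I_2,I_3\subseteq\{1,\dots,n\}$, let $\varphi^n_{(I_1,I_2,I_3)}(y,x)$ be the conjunction of $$\bigwedge_{i\in I_1}y_i\cdot x\bar x=0\wedge\bigwedge_{i\notin I_1}y_i\cdot x\bar x\neq0,\quad \bigwedge_{i\in I_2}y_i\cdot xx^*=0\wedge\bigwedge_{i\notin I_2}y_i\cdot xx^*\neq0,\quad \bigwedge_{i\in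 I_3}y_i\cdot x'\bar x=0\wedge\bigwedge_{i\notin I_3}y_i\cdot x'\bar x\neq0.$$ $\mathrm{ECBDA}$ consists of the axioms of Boole-De Morgan algebras and the sentences $$\forall y_1,\dots,y_n\Big(\bigwedge_iy_i\neq0\wedge\sum_{i=1}^ny_i=1\wedge\bigwedge_{i\neq j}y_i\cdot y_j=0\wedge\bigwedge_iy_i^*=y_{\sigma(i)}\rightarrow\exists x\,\varphi^n_{(I_1,I_2,I_3)}(y,x)\Big)$$ for each integer $n\ge1$, each $\sigma\in S_n$ with $\sigma^2$ the identity, and each $\sigma$-consistent triple $(I_1,I_2,I_3)$ of subsets of $\{1,\dots,n\}$. Theory $\mathrm{ECDA}$ (in the language $\{+,\cdot,\bar{\ },0,1\}$): for $I\subseteq\{1,\dots,n\}$ put $$\tilde\psi^n_I(y,x):=\bigwedge_{i\in I}y_i\cdot x\bar x=0\wedge\bigwedge_{i\notin I}y_i\cdot x\bar x\neq0,$$ $$\tilde\xi^n_I(y,x):=\exists z\Big(\bar x+z=1\wedge\bar xz=0\wedge\bigwedge_{i\in I}y_i\cdot xz=0\wedge\bigwedge_{i\notin I}y_i\cdot xz\neq0\Big),$$ $$\tilde\chi^n_I(y,x):=\exists z\Big(x+z=1\wedge xz=0\wedge\bigwedge_{i\in I}y_i\cdot z\bar x=0\wedge\bigwedge_{i\notin I}y_i\cdot z\bar x\neq0\Big),$$ and $\tilde\varphi^n_{(I_1,I_2,I_3)}:=\tilde\psi^n_{I_1}\wedge\tilde\xi^n_{I_2}\wedge\tilde\chi^n_{I_3}$.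 $\mathrm{ECDA}$ consists of the axioms of complemented De Morgan algebras and the sentences $$\forall y_1,\dots,y_n\Big(\bigwedge_iy_i\neq0\wedge\sum_{i=1}^ny_i=1\wedge\bigwedge_{i\neq j}y_iy_j=0\wedge\bigwedge_i(\bar y_i+y_{\sigma(i)}=1\wedge\bar y_iy_{\sigma(i)}=0)\rightarrow\exists x\,\tilde\varphi^n_{(I_1,I_2,I_3)}(y,x)\Big)$$ for the same range of $n$, $\sigma$ and $(I_1,I_2,I_3)$. *)

(* Defs.v *)
From mathcomp Require Import all_boot all_fingroup.

Set Implicit Arguments.
Unset Strict Implicit.
Unset Printing Implicit Defensive.

(** First-order terms and formulas, with named variables, over the language
    consisting of [+], [*], [0], [1] and a type [U] of unary function
    symbols. *)

Inductive term (U : Type) : Type :=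
| Var of nat
| Zero
| One
| Join of term U & term U
| Meet of term U & term U
| Un of U & term U.

Arguments Var {U}.
Arguments Zero {U}.
Arguments One {U}.

Inductive formula (U : Type) : Type :=
| Top
| Eq of term U & term U
| Not of formula U
| And of formula U & formula U
| Imp of formula U & formula U
| All of nat & formula U
| Ex of nat & formula U.

Arguments Top {U}.

Declare Scope fo_scope.
Delimit Scope fo_scope with fo.
Bind Scope fo_scope with term formula.

Notation "''v_' i" := (Var i) (at level 8, i at level 2, format "''v_' i")
  : fo_scope.
Notation "0" := Zero : fo_scope.
Notation "1" := One : fo_scope.
Notation "s + t" := (Join s t) : fo_scope.
Notation "s * t" := (Meet s t) : fo_scope.
Notation "s == t" := (Eq s t) : fo_scope.
Notation "s != t" := (Not (Eq s t)) : fo_scope.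
Notation "A /\ B" := (And A B) : fo_scope.
Notation "A ==> B" := (Imp A B) : fo_scope.
Definition Alls (U : Type) (s : seq nat) (A : formula U) : formula U :=
  foldr (@All U) A s.

Record structure (U : Type) : Type := Structure {
  carrier :> Type;
  zero : carrier;
  one : carrier;
  join : carrier -> carrier -> carrier;
  meet : carrier -> carrier -> carrier;
  unop : U -> carrier -> carrier
}.

Fixpoint eval (U : Type) (M : structure U) (v : nat -> M) (t : term U) : M :=
  match t with
  | Var i => v i
  | Zero => zero M
  | One => one M
  | Join s t => join (eval v s) (eval v t)
  | Meet s t => meet (eval v s) (eval v t)
  | Un u t => unop u (eval v t)
  end.

Definition update (T : Type) (v : nat -> T) (i : nat) (a : T) : nat -> T :=
  fun j => if j == i then a else v j.

Fixpoint sat (U : Type) (M : structure U) (v : nat -> M) (A : formula U)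
    : Prop :=
  match A with
  | Top => True
  | Eq s t => eval v s = eval v t
  | Not A => ~ sat v A
  | And A B => sat v A /\ sat v B
  | Imp A B => sat v A -> sat v B
  | All i A => forall a : M, sat (update v i a) A
  | Ex i A => exists a : M, sat (update v i a) A
  end.

(** All the theories below consist of closed formulas, whose satisfaction does
    not depend on the valuation. *)
Definition theory (U : Type) : Type := formula U -> Prop.

Definition models (U : Type) (M : structure U) (T : theory U) : Prop :=
  forall A : formula U, T A -> forall v : nat -> M, sat v A.

Definition is_iso (U : Type) (M N : structure U) (f : M -> N) : Prop :=
  [/\ bijective f,
      f (zero M) = zero N /\ f (one M) = one N,
      {morph f : x y / join x y >-> join x y},
      {morph f : x y / meet x y >-> meet x y} &
      forall u : U, {morph f : x / unop u x >-> unop u x}].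

Definition isomorphic (U : Type) (M N : structure U) : Prop :=
  exists f : M -> N, is_iso f.

Definition at_most_countable (T : Type) : Prop :=
  exists f : T -> nat, injective f.

Definition countably_infinite (T : Type) : Prop :=
  exists f : T -> nat, bijective f.

Definition unique_model (size : Type -> Prop) (U : Type) (T : theory U)
    : Prop :=
  (exists M : structure U, size M /\ models M T) /\
  (forall M N : structure U,
     size M -> size N -> models M T -> models N T -> isomorphic M N).

Definition aleph0_categorical (U : Type) (T : theory U) : Prop :=
  unique_model countably_infinite T.

(** The variant in which finite models also count as countable. *)
Definition has_unique_countable_model (U : Type) (T : theory U) : Prop :=
  unique_model at_most_countable T.

Local Open Scope fo_scope.

(** With the convention that 0 and 1 are distinct. *)
Variant bounded_distributive_lattice (U : Type) : theory U :=
| JoinC : bounded_distributive_lattice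
    (Alls [:: 0; 1]%N ('v_0 + 'v_1 == 'v_1 + 'v_0))
| MeetC : bounded_distributive_lattice
    (Alls [:: 0; 1]%N ('v_0 * 'v_1 == 'v_1 * 'v_0))
| JoinA : bounded_distributive_lattice
    (Alls [:: 0; 1; 2]%N ('v_0 + ('v_1 + 'v_2) == ('v_0 + 'v_1) + 'v_2))
| MeetA : bounded_distributive_lattice
    (Alls [:: 0; 1; 2]%N ('v_0 * ('v_1 * 'v_2) == ('v_0 * 'v_1) * 'v_2))
| JoinK : bounded_distributive_lattice
    (Alls [:: 0; 1]%N ('v_0 + 'v_0 * 'v_1 == 'v_0))
| MeetK : bounded_distributive_lattice
    (Alls [:: 0; 1]%N ('v_0 * ('v_0 + 'v_1) == 'v_0))
| MeetJoinD : bounded_distributive_lattice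
    (Alls [:: 0; 1; 2]%N
       ('v_0 * ('v_1 + 'v_2) == 'v_0 * 'v_1 + 'v_0 * 'v_2))
| Join0 : bounded_distributive_lattice (All 0 ('v_0 + 0 == 'v_0))
| Meet1 : bounded_distributive_lattice (All 0 ('v_0 * 1 == 'v_0))
| ZeroNeqOne : bounded_distributive_lattice (0 != 1).

Variant de_morgan_algebra (U : Type) (bar : U) : theory U :=
| DeMorgan_lattice A of bounded_distributive_lattice A :
    de_morgan_algebra bar A
| BarK : de_morgan_algebra bar (All 0 (Un bar (Un bar 'v_0) == 'v_0))
| BarJoin : de_morgan_algebra bar
    (Alls [:: 0; 1]%N
       (Un bar ('v_0 + 'v_1) == Un bar 'v_0 * Un bar 'v_1)).

Variant complemented_de_morgan_algebra (U : Type) (bar : U) : theory U :=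
| Complemented_de_morgan A of de_morgan_algebra bar A :
    complemented_de_morgan_algebra bar A
| Complemented : complemented_de_morgan_algebra bar
    (All 0 (Ex 1 ('v_0 * 'v_1 == 0 /\ 'v_0 + 'v_1 == 1))).

Variant boolean_algebra (U : Type) (compl : U) : theory U :=
| Boolean_lattice A of bounded_distributive_lattice A :
    boolean_algebra compl A
| MeetCompl : boolean_algebra compl (All 0 ('v_0 * Un compl 'v_0 == 0))
| JoinCompl : boolean_algebra compl (All 0 ('v_0 + Un compl 'v_0 == 1)).

Variant bda_symbol : Type := bda_compl | bda_bar.

Variant da_symbol : Type := da_bar.

Variant boole_de_morgan_algebra : theory bda_symbol :=
| BDA_boolean A of boolean_algebra bda_compl A : boole_de_morgan_algebra A
| BDA_de_morgan A of de_morgan_algebra bda_bar A : boole_de_morgan_algebra A.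

(** From here on [{1, ..., n}] is ['I_n], [y_i] is the variable ['v_i] for
    [i < n], [x] is ['v_n] and [z] is ['v_n.+1], so no variable is captured. *)

Definition consistent (n : nat) (s : 'S_n) (I1 I2 I3 : {set 'I_n}) : Prop :=
  [/\ s @: I2 = I2, s @: I3 = I3 &
      (I1 :&: I2 :&: I3) :&: (s @: (I1 :&: I2 :&: I3)) = set0].

Definition zero_pattern (U : Type) (n : nat) (I : {set 'I_n}) (t : term U)
    : formula U :=
  (\big[@And U/Top]_(i < n | i \in I) ('v_i * t == 0)) /\
  (\big[@And U/Top]_(i < n | i \notin I) ('v_i * t != 0)).

Definition ec_premise (U : Type) (n : nat) (starred : 'I_n -> formula U)
    : formula U :=
  (\big[@And U/Top]_(i < n) ('v_i != 0)) /\
  (\big[@Join U/Zero]_(i < n) 'v_i == 1) /\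
  (\big[@And U/Top]_(p : 'I_n * 'I_n | p.1 != p.2) ('v_(p.1) * 'v_(p.2) == 0)) /\
  (\big[@And U/Top]_(i < n) starred i).

Definition phi (n : nat) (I1 I2 I3 : {set 'I_n}) : formula bda_symbol :=
  let x := 'v_n in
  let compl := Un bda_compl in
  let bar := Un bda_bar in
  let star t := compl (bar t) in
  zero_pattern I1 (x * bar x) /\
  zero_pattern I2 (x * star x) /\
  zero_pattern I3 (compl x * bar x).

Definition ecbda_sentence (n : nat) (s : 'S_n) (I1 I2 I3 : {set 'I_n})
    : formula bda_symbol :=
  Alls (iota 0 n)
    (ec_premise (fun i => Un bda_compl (Un bda_bar 'v_i) == 'v_(s i))
     ==> Ex n (phi I1 I2 I3)).

Variant ECBDA : theory bda_symbol :=
| ECBDA_bda A of boole_de_morgan_algebra A : ECBDA A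
| ECBDA_ec (n : nat) (s : 'S_n) (I1 I2 I3 : {set 'I_n})
    of (0 < n)%N & (s ^+ 2)%g = 1%g & consistent s I1 I2 I3 :
    ECBDA (ecbda_sentence s I1 I2 I3).

Definition tilde_psi (n : nat) (I : {set 'I_n}) : formula da_symbol :=
  zero_pattern I ('v_n * Un da_bar 'v_n).

Definition tilde_xi (n : nat) (I : {set 'I_n}) : formula da_symbol :=
  let x := 'v_n in
  let z := 'v_n.+1 in
  let bar := Un da_bar in
  Ex n.+1 (bar x + z == 1 /\ bar x * z == 0 /\ zero_pattern I (x * z)).

Definition tilde_chi (n : nat) (I : {set 'I_n}) : formula da_symbol :=
  let x := 'v_n in
  let z := 'v_n.+1 in
  let bar := Un da_bar in
  Ex n.+1 (x + z == 1 /\ x * z == 0 /\ zero_pattern I (z * bar x)).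

Definition tilde_phi (n : nat) (I1 I2 I3 : {set 'I_n}) : formula da_symbol :=
  tilde_psi I1 /\ tilde_xi I2 /\ tilde_chi I3.

Definition ecda_sentence (n : nat) (s : 'S_n) (I1 I2 I3 : {set 'I_n})
    : formula da_symbol :=
  Alls (iota 0 n)
    (ec_premise (fun i => Un da_bar 'v_i + 'v_(s i) == 1 /\
                          Un da_bar 'v_i * 'v_(s i) == 0)
     ==> Ex n (tilde_phi I1 I2 I3)).

Variant ECDA : theory da_symbol :=
| ECDA_da A of complemented_de_morgan_algebra da_bar A : ECDA A
| ECDA_ec (n : nat) (s : 'S_n) (I1 I2 I3 : {set 'I_n})
    of (0 < n)%N & (s ^+ 2)%g = 1%g & consistent s I1 I2 I3 :
    ECDA (ecda_sentence s I1 I2 I3).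

(* Main.v *)
(** With [star x := (bar x)'], a Boole-De Morgan algebra is a Boolean algebra
    with an involutive automorphism, and a complemented De Morgan algebra is a
    reduct of one, since complements are unique.  A finite subalgebra is a
    partition of [1] permuted by [star]; adjoining [x] splits each block along
    [x] and [star x], and the isomorphism type of the result only depends on
    which of the pieces vanish.  The consistency condition says exactly that
    no nonzero block loses all its pieces, so the axioms realise every
    one-generator extension of a finite subalgebra, and any two countable
    models are isomorphic by back and forth.

    For existence, take [A * A] with the swap of the two factors, where [A] is
    the countable atomless algebra of periodic subsets of [nat]. *)
From HB Require Import structures.
From mathcomp Require Import all_boot all_order all_fingroup.
From mathcomp Require Import boolp classical_sets functions cardinality.
Require Import Defs.

Set Implicit Arguments.
Unset Strict Implicit.
Unset Printing Implicit Defensive.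

Import Order.TTheory Order.CTheory.

(** * Boolean algebras with an involution *)

(** The laws are those of the first-order axioms, so that a model supplies the lattice fields
    directly. *)
Record boolean_ops (T : Type) : Type := BooleanOps {
  ba0 : T;
  ba1 : T;
  baU : T -> T -> T;
  baI : T -> T -> T;
  baC : T -> T;
  baUC : commutative baU;
  baIC : commutative baI;
  baUA : associative baU;
  baIA : associative baI;
  baUK : forall x y, baU x (baI x y) = x;
  baIK : forall x y, baI x (baU x y) = x;
  baIU : right_distributive baI baU;
  baU0 : right_id ba0 baU;
  baI1 : right_id ba1 baI;
  baIN : forall x, baI x (baC x) = ba0;
  baUN : forall x, baU x (baC x) = ba1
}.

(** The argument [m] is kept in the type so that the order structure inferred on it is the one
    induced by [m]. *)
Definition boolean_sort (T : Type) (m : boolean_ops T) : Type := T.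

Section BooleanOrder.

Variables (T : Type) (m : boolean_ops T).
Local Notation B := (boolean_sort m).

HB.instance Definition _ := gen_eqMixin B.
HB.instance Definition _ := gen_choiceMixin B.

Let le (x y : B) : bool := (baI m x y : B) == x.
Let lt (x y : B) : bool := (y != x) && le x y.

Fact boolean_meetUl : left_distributive (baI m) (baU m).
Proof. by move=> x y z; rewrite baIC baIU ![baI m z _]baIC. Qed.

Fact boolean_meetxx : idempotent_op (baI m).
Proof. by move=> x; rewrite -{2}[x](baUK m x x) baIK. Qed.

HB.instance Definition _ :=
  Order.isMeetJoinDistrLattice.Build (Order.Disp tt tt) B
    (le := le) (lt := lt) (meet := baI m) (join := baU m)
    (fun _ _ => erefl) (fun _ _ => erefl) (@baIC _ m) (@baUC _ m)
    (@baIA _ m) (@baUA _ m) (fun y x => baIK m x y) (fun y x => baUK m x y)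
    boolean_meetUl boolean_meetxx.

Fact boolean_le0x (x : B) : Order.le (ba0 m : B) x.
Proof.
by apply/eqP; rewrite /= -[X in baI m _ X](baU0 m) (baUC m) baIK.
Qed.

Fact boolean_lex1 (x : B) : Order.le x (ba1 m : B).
Proof. by apply/eqP; rewrite /= baI1. Qed.

HB.instance Definition _ :=
  Order.hasBottom.Build (Order.Disp tt tt) B boolean_le0x.
HB.instance Definition _ :=
  Order.hasTop.Build (Order.Disp tt tt) B boolean_lex1.
HB.instance Definition _ :=
  Order.TBDistrLattice_hasComplement.Build (Order.Disp tt tt) B
    (baUN m) (baIN m).

End BooleanOrder.

Local Open Scope order_scope.

(** * Involutive automorphisms and the partitions they permute *)

Section Involution.

Variables (d : Order.disp_t) (T : ctbDistrLatticeType d).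
Implicit Types (x y : T) (star : T -> T).

Definition is_involution star : Prop :=
  [/\ involutive star, {morph star : x y / x `&` y}
    & {morph star : x / ~` x}].

Definition extension_property star : Prop :=
  forall (n : nat) (s : 'S_n) (I1 I2 I3 : {set 'I_n}),
    (0 < n)%N -> (s ^+ 2)%g = 1%g -> consistent s I1 I2 I3 ->
  forall y : 'I_n -> T,
    (forall i, y i <> \bot) -> \join_i y i = \top ->
    (forall i j, i != j -> y i `&` y j = \bot) ->
    (forall i, star (y i) = y (s i)) ->
  exists x, forall i,
    [/\ i \in I1 <-> y i `&` (x `&` ~` star x) = \bot,
        i \in I2 <-> y i `&` (x `&` star x) = \bot
      & i \in I3 <-> y i `&` (~` x `&` ~` star x) = \bot].

Lemma eq_meet_joins (J : finType) (y : J -> T) x x' :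
  \join_j y j = \top -> (forall j, y j `&` x = y j `&` x') -> x = x'.
Proof.
move=> y1 eq_x; rewrite -[x]meet1x -[x']meet1x -y1.
have distr z : (\join_j y j) `&` z = \join_j (y j `&` z).
  by apply: (big_morph (fun u => u `&` z)) => [a b|]; rewrite (meetUl, meet0x).
by rewrite !distr; apply: eq_bigr.
Qed.

Section InvolutionTheory.

Variables (star : T -> T) (starP : is_involution star).

Let starK : involutive star. Proof. by case: starP. Qed.
Let starI : {morph star : x y / x `&` y}. Proof. by case: starP. Qed.
Let starC : {morph star : x / ~` x}. Proof. by case: starP. Qed.

Lemma star_join : {morph star : x y / x `|` y}.
Proof.
by move=> x y; apply: compl_inj; rewrite complU -starC complU starI !starC.
Qed.

Lemma star_bot : star \bot = \bot.
Proof. by rewrite -(meetxC (\bot : T)) starI starC !meetxC. Qed.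

Lemma star_top : star \top = \top.
Proof. by rewrite -compl0 starC star_bot. Qed.

Lemma star_eq0 x : (star x = \bot) <-> (x = \bot).
Proof. by split=> [/(congr1 star)|->]; rewrite ?starK star_bot. Qed.

Section Partition.

Variables (J : finType) (s : J -> J) (y : J -> T).

Definition star_partition : Prop :=
  [/\ \join_j y j = \top, forall i j, i != j -> y i `&` y j = \bot
    & forall j, star (y j) = y (s j)].

(** The extension property without the requirement that the blocks of the
    partition be nonzero. *)
Lemma extension_finType (P1 P2 P3 : pred J) :
  extension_property star -> \bot <> \top :> T -> involutive s ->
  star_partition ->
  (forall j, y j = \bot -> [&& P1 j, P2 j & P3 j]) ->
  (forall j, P2 (s j) = P2 j) -> (forall j, P3 (s j) = P3 j) ->
  (forall j, [&& P1 j, P1 (s j), P2 j & P3 j] -> y j = \bot) ->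
  exists x, forall j,
    [/\ P1 j <-> y j `&` (x `&` ~` star x) = \bot,
        P2 j <-> y j `&` (x `&` star x) = \bot
      & P3 j <-> y j `&` (~` x `&` ~` star x) = \bot].
Proof.
move=> starE T_neq sK [yU yI ys] P0 P2s P3s Py.
pose A := [set j | y j != \bot].
have As j : j \in A -> s j \in A.
  rewrite !inE -ys; apply: contra => /eqP /star_eq0 ->; exact: eqxx.
have [a Aa] : exists a, a \in A.
  case: (set_0Vmem A) => [A0|[a aA]]; last by exists a.
  case: T_neq.
  rewrite -yU big1 // => j _; apply/eqP; rewrite -[_ == _]negbK.
  by have := finset.in_set0 j; rewrite -A0 inE => ->.
(* The nonzero blocks are numbered by an ordinal, and [s] is carried over to a permutation of it. *)
pose t (i : 'I_#|A|) := enum_rank_in Aa (s (enum_val i)).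
have tE i : enum_val (t i) = s (enum_val i).
  by rewrite enum_rankK_in // As // enum_valP.
have tK : involutive t.
  by move=> i; apply: enum_val_inj; rewrite !tE sK.
pose p := perm (inv_inj tK).
have p_imset (I : {set 'I_#|A|}) :
    (forall i, (t i \in I) = (i \in I)) -> p @: I = I.
  move=> It; apply/setP=> i; apply/imsetP/idP => [[k kI ->]|iI].
    by rewrite permE It.
  by exists (t i); rewrite ?It // permE tK.
have tt1 : (p ^+ 2)%g = 1%g.
  by apply/permP=> i; rewrite expgS expg1 permM !permE tK.
have Icons : consistent p [set i | P1 (enum_val i)] [set i | P2 (enum_val i)]
    [set i | P3 (enum_val i)].
  split; [by apply: p_imset => i; rewrite !inE tE.. |].
  (* An index violating consistency satisfies [P1] together with its image under [s], as well as
     [P2] and [P3]; the last hypothesis then makes its block zero. *)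
  apply/setP=> i; rewrite !inE; apply/negP => /andP[/andP[/andP[P1i P2i] P3i]].
  case/imsetP=> k; rewrite !inE permE => /andP[/andP[P1k _] _] ik.
  have := enum_valP i; rewrite inE Py ?eqxx // P1i P2i P3i !andbT /=.
  by rewrite ik tE sK.
have [|i|||i|x xP] := starE _ p _ _ _ _ tt1 Icons (fun i => y (enum_val i)).
- by apply/card_gt0P; exists a.
- by have := enum_valP i; rewrite inE => /eqP.
- rewrite -yU -(big_enum_val y) [RHS](bigID (mem A)) /=.
  rewrite [X in _ `|` X]big1 ?joinx0 // => j.
  by rewrite inE negbK => /eqP.
- by move=> i j neq_ij; apply: yI; rewrite (inj_eq enum_val_inj).
- by rewrite permE ys tE.
exists x => j; have [jA|] := boolP (j \in A).
  by have := xP (enum_rank_in Aa j); rewrite !inE enum_rankK_in.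
rewrite inE negbK => /eqP y0; rewrite y0 !meet0x.
by have /and3P[-> -> ->] := P0 j y0.
Qed.

Definition literal (b : bool) x : T := if b then x else ~` x.

(** The index [(b, c, j)] stands for the piece of block [j] with sign [b] for [x] and [c] for
    [star x]. As [star] exchanges [x] and [star x], it exchanges the two signs. *)
Definition refine_swap (k : bool * bool * J) : bool * bool * J :=
  (k.1.2, k.1.1, s k.2).

Definition refine x (k : bool * bool * J) : T :=
  y k.2 `&` (literal k.1.1 x `&` literal k.1.2 (star x)).

Lemma refine_swapK : involutive s -> involutive refine_swap.
Proof. by move=> sK [[b c] j]; rewrite /refine_swap /= sK. Qed.

Lemma star_literal b x : star (literal b x) = literal b (star x).
Proof. by case: b => //=; rewrite starC. Qed.

Lemma literal_disjoint b c x :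
  b != c -> literal b x `&` literal c x = \bot.
Proof. by case: b c => [] [] // _; rewrite (meetxC, meetCx). Qed.

Lemma le_literal_meet b c u x x' :
  u <= literal b x -> u <= literal c x' -> u <= literal (b && c) (x `&` x').
Proof.
case: b c => [] [] /= ux ux'; rewrite ?complI.
- by rewrite lexI ux.
- exact: lexUr.
- exact: lexUl.
- exact: lexUl.
Qed.

Lemma literal_split x z :
  (z `&` literal true x) `|` (z `&` literal false x) = z.
Proof. by rewrite /= -meetUr joinxC meetx1. Qed.

Lemma meet_eq0W u u' v v' :
  u <= u' -> v <= v' -> u' `&` v' = \bot -> u `&` v = \bot :> T.
Proof. by move=> uu vv uv; apply/eqP; rewrite -lex0 -uv leI2. Qed.

(** The four pieces of a block join to the block. With the join of all pieces as [u] this shows that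
    the pieces cover; with [\bot], that a block without nonzero piece is zero. *)
Lemma refine_le x j u : (forall b c, refine x (b, c, j) <= u) -> y j <= u.
Proof.
move=> le_u; have le_literal b : y j `&` literal b x <= u.
  by rewrite -(literal_split (star x) (_ `&` _)) leUx -!meetA !le_u.
by rewrite -(literal_split x (y j)) leUx !le_literal.
Qed.

End Partition.

Lemma refine_partition (J : finType) (s : J -> J) (y : J -> T) x :
  star_partition s y -> star_partition (refine_swap s) (refine y x).
Proof.
move=> [yU yI ys]; split.
- apply/eqP; rewrite -le1x -yU; apply/joinsP => j _.
  by apply: (refine_le (x := x)) => b c; apply: joins_sup.
(* Distinct indices differ in the block, in the sign of [x] or in the sign of [star x], and each
   difference alone forces disjointness. *)
- move=> [[b c] i] [[b' c'] j] neq; rewrite /refine /=.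
  have [eq_ij|neq_ij] := eqVneq i j; last first.
    by apply: meet_eq0W (leIl _ _) (leIl _ _) (yI _ _ neq_ij).
  have [eq_b|neq_b] := eqVneq b b'; last first.
    by apply: meet_eq0W (literal_disjoint x neq_b); rewrite leIx2 // leIl orbT.
  have [eq_c|neq_c] := eqVneq c c'; last first.
    by apply: meet_eq0W (literal_disjoint (star x) neq_c);
      rewrite leIx2 // leIr orbT.
  by rewrite eq_ij eq_b eq_c eqxx in neq.
- move=> [[b c] j]; rewrite /refine /= !starI !star_literal starK ys.
  by rewrite [literal b _ `&` _]meetC.
Qed.

End InvolutionTheory.
End Involution.

(** * Finite partial isomorphisms *)

Section PartialIsomorphism.

Variables (d1 d2 : Order.disp_t).
Variables (T1 : ctbDistrLatticeType d1) (T2 : ctbDistrLatticeType d2).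
Variables (star1 : T1 -> T1) (star2 : T2 -> T2).

(** An isomorphism between finite subalgebras, given by matching their atoms;
    indices of zero blocks are allowed and carry no information. *)
Record partial_iso : Type := PartialIso {
  block : finType;
  bswap : block -> block;
  lblock : block -> T1;
  rblock : block -> T2;
  bswapK : involutive bswap;
  lblockP : star_partition star1 bswap lblock;
  rblockP : star_partition star2 bswap rblock;
  block_eq0 : forall j, lblock j = \bot <-> rblock j = \bot
}.

(** [x1] and [x2] are the joins of corresponding sets of blocks. *)
Definition graph (p : partial_iso) (x1 : T1) (x2 : T2) : Prop :=
  forall j : block p, lblock j <> \bot ->
  exists b, lblock j <= literal b x1 /\ rblock j <= literal b x2.

Lemma graph_meet p x1 x2 y1 y2 :
  graph p x1 x2 -> graph p y1 y2 -> graph p (x1 `&` y1) (x2 `&` y2).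
Proof.
move=> xP yP j j0.
case: (xP j j0) (yP j j0) => b [bx1 bx2] [c [cy1 cy2]].
by exists (b && c); split; apply: le_literal_meet.
Qed.

Lemma graph_compl p x1 x2 : graph p x1 x2 -> graph p (~` x1) (~` x2).
Proof.
move=> xP j j0; case: (xP j j0) => b [bx1 bx2].
by exists (~~ b); case: b bx1 bx2 => /=; rewrite ?complK.
Qed.

(** The sign of [star x] on a block is the sign of [x] on the swapped block, which is nonzero as
    well. *)
Lemma graph_star p x1 x2 :
  is_involution star1 -> is_involution star2 ->
  graph p x1 x2 -> graph p (star1 x1) (star2 x2).
Proof.
move=> i1 i2 xP j j0; case: (lblockP p) (rblockP p) => _ _ ls [_ _ rs].
have [|b [bx1 bx2]] := xP (bswap j); first by rewrite -ls (star_eq0 i1).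
exists b; have mono d (T : ctbDistrLatticeType d) (star : T -> T) u v :
    is_involution star -> star u <= literal b v -> u <= literal b (star v).
  case=> sK sI sC uv; rewrite -[u]sK -star_literal //.
  by rewrite leEmeet -sI; move: uv; rewrite leEmeet => /eqP ->.
by split; apply: mono => //; rewrite (ls, rs).
Qed.

(** A nonzero block cannot lie below both a literal and its opposite, so [x1] fixes the sign on
    every nonzero block and with it the right-hand element. *)
Lemma graph_functional p x1 x2 y2 : graph p x1 x2 -> graph p x1 y2 -> x2 = y2.
Proof.
move=> xP yP; case: (rblockP p) => rU _ _; apply: (eq_meet_joins rU) => j.
have [/block_eq0 ->|j0] := pselect (lblock j = \bot); first by rewrite !meet0x.
case: (xP j j0) => b [bx1 bx2]; case: (yP j j0) => c [cx1 cy2].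
have [eq_bc|neq_bc] := eqVneq b c; last first.
  by case: j0; rewrite -[lblock j]meetxx (meet_eq0W bx1 cx1) ?literal_disjoint.
move: bx2 cy2; rewrite -{}eq_bc; case: b {bx1 cx1} => /=.
  by move=> /meet_l-> /meet_l->.
by rewrite -!disj_leC => /eqP-> /eqP->.
Qed.

(** Both partitions are refined, the left one by [x1] and the right one by an [x2] for which the
    same pieces vanish. *)
Lemma partial_iso_forth p x1 :
    is_involution star1 -> is_involution star2 ->
    extension_property star2 -> \bot <> \top :> T2 ->
  exists q, (forall u v, graph p u v -> graph q u v) /\
            exists x2, graph q x1 x2.
Proof.
move=> i1 i2 ec2 nt2; case: (lblockP p) (rblockP p) => lU lI ls [rU rI rs].
have [star1K star1I star1C] := i1; have [star2K star2I star2C] := i2.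
have star_refine1 j b c : star1 (refine star1 (@lblock p) x1 (b, c, j)) =
    refine star1 (@lblock p) x1 (c, b, bswap j).
  by have [_ _ ->] := refine_partition i1 x1 (lblockP p).
have star_refine2 x2 j b c : star2 (refine star2 (@rblock p) x2 (b, c, j)) =
    refine star2 (@rblock p) x2 (c, b, bswap j).
  by have [_ _ ->] := refine_partition i2 x2 (rblockP p).
(* The vanishing pattern of [x1], to be realised on the right. *)
pose zero b c := [pred j | refine star1 (@lblock p) x1 (b, c, j) == \bot].
have zero_swap b c j : zero b c (bswap j) = zero c b j.
  rewrite /zero /= -star_refine1; apply/eqP/eqP => [/(star_eq0 i1)|->] //.
  exact: star_bot.
have [|j|j|j|x2 x2P] := @extension_finType _ _ _ i2 _ _ _
    (zero true false) (zero true true) (zero false false) ec2 nt2 (@bswapK p)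
    (rblockP p).
- by move=> j /block_eq0 j0; rewrite /zero /refine /= j0 !meet0x eqxx.
- exact: zero_swap.
- exact: zero_swap.
(* By [zero_swap] the condition at [bswap j] concerns the fourth piece of block [j]; all four
   vanish, hence so does the block. *)
- rewrite zero_swap => /and4P[/eqP z1 /eqP z2 /eqP z3 /eqP z4].
  apply/block_eq0/eqP; rewrite -lex0.
  apply: (refine_le (star := star1) (x := x1)).
  by case=> [] []; rewrite (z1, z2, z3, z4).
have eq0 k : refine star1 (@lblock p) x1 k = \bot <->
             refine star2 (@rblock p) x2 k = \bot.
  case: k => [[[] []] j]; have [P1 P2 P3] := x2P j.
  - by apply: iff_trans P2; split=> /eqP.
  - by apply: iff_trans P1; split=> /eqP.
  (* The piece with signs false, true is not prescribed directly; it is the star image of the piece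
     with signs true, false of the swapped block. *)
  - have [P1' _ _] := x2P (bswap j).
    rewrite -[j](bswapK) -star_refine1 -star_refine2.
    apply: iff_trans (star_eq0 i1 _) _.
    apply: iff_trans (iff_sym (star_eq0 i2 _)).
    by apply: iff_trans P1'; split=> /eqP.
  - by apply: iff_trans P3; split=> /eqP.
exists (@PartialIso _ (refine_swap (@bswap p)) (refine star1 (@lblock p) x1)
  (refine star2 (@rblock p) x2) (refine_swapK (@bswapK p))
  (refine_partition i1 x1 (lblockP p)) (refine_partition i2 x2 (rblockP p))
  eq0).
(* Pairs already related stay related because every piece lies below its block. *)
split=> [u v uv [[b c] j] /= j0|].
  have [|a [au av]] := uv j.
    by move=> l0; case: j0; rewrite /refine l0 meet0x.
  by exists a; split; apply: le_trans (leIl _ _) _.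
exists x2 => -[[b c] j] _; exists b; split; rewrite /= /refine /=.
  by rewrite meetCA leIl.
by rewrite meetCA leIl.
Qed.

End PartialIsomorphism.

Section InversePartialIsomorphism.

Variables (d1 d2 : Order.disp_t).
Variables (T1 : ctbDistrLatticeType d1) (T2 : ctbDistrLatticeType d2).
Variables (star1 : T1 -> T1) (star2 : T2 -> T2).

Definition partial_iso_inv (p : partial_iso star1 star2) :
    partial_iso star2 star1 :=
  PartialIso (@bswapK _ _ _ _ _ _ p) (rblockP p) (lblockP p)
    (fun j => iff_sym (block_eq0 j)).

Lemma graph_inv p x1 x2 : graph (partial_iso_inv p) x2 x1 <-> graph p x1 x2.
Proof.
by split=> xP j /block_eq0 j0; have [b [bx1 bx2]] := xP j j0; exists b.
Qed.

End InversePartialIsomorphism.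

(** The one-block partition, whose subalgebra consists of [\bot] and [\top]: the start of the back
    and forth. *)
Lemma unit_partition d (T : ctbDistrLatticeType d) (star : T -> T) :
  is_involution star -> star_partition star (@id unit) (fun=> \top).
Proof.
move=> starP; split=> [|[] []|_] //; last exact: star_top.
by rewrite (big_pred1 tt) // => -[].
Qed.

(** * Back and forth between countable algebras *)

Section BackAndForth.

Variables (d1 d2 : Order.disp_t).
Variables (T1 : ctbDistrLatticeType d1) (T2 : ctbDistrLatticeType d2).
Variables (star1 : T1 -> T1) (star2 : T2 -> T2).
Hypotheses (i1 : is_involution star1) (i2 : is_involution star2).
Hypotheses (e1 : extension_property star1) (e2 : extension_property star2).
Hypotheses (nt1 : \bot <> \top :> T1) (nt2 : \bot <> \top :> T2).

Let iso := partial_iso star1 star2.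
Let extends (p q : iso) := forall u v, graph p u v -> graph q u v.

Lemma partial_iso_back (p : iso) x2 :
  exists q, extends p q /\ exists x1, graph q x1 x2.
Proof.
have [q [pq [x1 x12]]] :=
  partial_iso_forth (partial_iso_inv p) x2 i2 i1 e1 nt1.
exists (partial_iso_inv q); split; last by exists x1; apply/graph_inv.
by move=> u v /graph_inv uv; apply/graph_inv/pq.
Qed.

Variables (f1 : T1 -> nat) (f2 : T2 -> nat).
Hypotheses (f1_inj : injective f1) (f2_inj : injective f2).

Lemma partial_iso_step (p : iso) n :
  exists q, [/\ extends p q, forall u, f1 u = n -> exists v, graph q u v
                & forall v, f2 v = n -> exists u, graph q u v].
Proof.
have [q [pq qn]] : exists q, extends p q /\
    forall u, f1 u = n -> exists v, graph q u v.
  (* The numbering is only injective, so [n] may number no element; the partial isomorphism is then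
     kept. *)
  have [[u <-]|no_u] := pselect (exists u, f1 u = n); last first.
    by exists p; split=> // u un; case: no_u; exists u.
  have [q [pq [v uv]]] := partial_iso_forth p u i1 i2 e2 nt2.
  by exists q; split=> // _ /f1_inj ->; exists v.
have [[v vn]|no_v] := pselect (exists v, f2 v = n); last first.
  by exists q; split=> // v vn; case: no_v; exists v.
have [r [qr uv]] := partial_iso_back q v.
exists r; split=> [a b /pq /qr //|u un|w].
  by have [w uw] := qn u un; exists w; apply: qr.
by rewrite -vn => /f2_inj ->.
Qed.

Theorem back_and_forth :
  exists f : T1 -> T2, [/\ bijective f, {morph f : x y / x `&` y},
    {morph f : x / ~` x} & forall x, f (star1 x) = star2 (f x)].
Proof.
have p0 : iso.
  apply: (@PartialIso _ _ _ _ _ _ unit id _ _ _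
    (unit_partition i1) (unit_partition i2)) => //.
  by split=> /esym.
have [next nextP] := choice (fun pn : iso * nat => partial_iso_step pn.1 pn.2).
(* Stage [n.+1] of the chain takes care of the elements numbered [n] on both sides. *)
pose p := fix p n := if n is n'.+1 then next (p n', n') else p0.
pose U x1 x2 := exists n, graph (p n) x1 x2.
have p_mono m n u v : (m <= n)%N -> graph (p m) u v -> graph (p n) u v.
  elim: n => [|n IHn]; first by rewrite leqn0 => /eqP ->.
  rewrite leq_eqVlt => /predU1P[-> //|/IHn pmn /pmn uv].
  by have [+ _ _] := nextP (p n, n); apply.
(* Any two related pairs lie in a common stage, so the properties of a single graph pass to the
   union. *)
have U2 x1 x2 y1 y2 : U x1 x2 -> U y1 y2 ->
    exists n, graph (p n) x1 x2 /\ graph (p n) y1 y2.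
  move=> [m xP] [n yP]; exists (maxn m n).
  split; first exact: (p_mono _ _ _ _ (leq_maxl m n) xP).
  exact: (p_mono _ _ _ _ (leq_maxr m n) yP).
have U_fun x1 x2 y2 : U x1 x2 -> U x1 y2 -> x2 = y2.
  by move=> xP yP; have [n [xn yn]] := U2 _ _ _ _ xP yP;
    apply: graph_functional xn yn.
have U_inj x1 x2 y1 : U x1 x2 -> U y1 x2 -> x1 = y1.
  move=> xP yP; have [n [/graph_inv xn /graph_inv yn]] := U2 _ _ _ _ xP yP.
  exact: graph_functional xn yn.
have U_total x : exists v, U x v.
  have [_ /(_ x erefl)[v xv] _] := nextP (p (f1 x), f1 x).
  by exists v, (f1 x).+1.
have U_onto x : exists u, U u x.
  have [_ _ /(_ x erefl)[u ux]] := nextP (p (f2 x), f2 x).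
  by exists u, (f2 x).+1.
have [f fP] := choice U_total; have [g gP] := choice U_onto.
exists f; split.
- by exists g => x; [apply: U_inj (gP _) (fP _) | apply: U_fun (fP _) (gP _)].
- move=> x y; have [n [xn yn]] := U2 _ _ _ _ (fP x) (fP y).
  by apply: U_fun (fP _) _; exists n; apply: graph_meet.
- move=> x; have [n xn] := fP x.
  by apply: U_fun (fP _) _; exists n; apply: graph_compl.
- move=> x; have [n xn] := fP x.
  by apply: U_fun (fP _) _; exists n; apply: graph_star.
Qed.

End BackAndForth.

(** * Satisfaction *)

Section Semantics.

Variables (U : Type) (M : structure U).
Implicit Types (v w : nat -> M) (A : formula U).

(** A block of universal quantifiers is read as one quantifier over valuations, which avoids nested
    updates. *)
Lemma sat_Alls v s A :
  sat v (Alls s A) <->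
  (forall w, (forall k, k \notin s -> w k = v k) -> sat w A).
Proof.
elim: s v => [|i s IHs] v /=.
  split=> [vA w wv|]; last exact.
  by have -> : w = v by apply: funext => k; apply: wv.
split=> [vA w wv|vA a].
  move/IHs: (vA (w i)); apply=> k ks.
  rewrite /update; case: eqP => [-> //|/eqP ki].
  by apply: wv; rewrite inE negb_or ki.
apply/IHs => w wv; apply: vA => k; rewrite inE negb_or => /andP[ki ks].
by rewrite wv // /update (negPf ki).
Qed.

Lemma sat_And v A B : sat v (And A B) = (sat v A /\ sat v B).
Proof. by []. Qed.

Lemma sat_big_And (J : finType) (P : pred J) (F : J -> formula U) v :
  sat v (\big[@And U/Top]_(j | P j) F j) <-> (forall j, P j -> sat v (F j)).
Proof.
have -> : (forall j, P j -> sat v (F j)) <->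
    (forall j, j \in index_enum J -> P j -> sat v (F j)).
  by split=> H j; [move=> _; apply: H | apply: H; rewrite mem_index_enum].
elim: (index_enum J) => [|k r IHr]; first by rewrite big_nil.
rewrite big_cons; case: ifP => Pk /=; rewrite IHr; split.
- by move=> [Fk Fr] j; rewrite inE => /predU1P[-> //|]; apply: Fr.
- by move=> Fr; split=> [|j jr]; apply: Fr; rewrite ?mem_head // inE jr orbT.
- by move=> Fr j; rewrite inE => /predU1P[->|]; [rewrite Pk | apply: Fr].
- by move=> Fr j jr; apply: Fr; rewrite inE jr orbT.
Qed.

Lemma eval_big_Join (J : finType) (F : J -> term U) v :
  eval v (\big[@Join U/Zero]_j F j) = \big[@join U M/zero M]_j eval v (F j).
Proof. exact: (big_morph (eval v)). Qed.

Lemma sat_zero_pattern n (I : {set 'I_n}) t w :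
  sat w (zero_pattern I t) <->
  (forall i, i \in I <-> meet (w i) (eval w t) = zero M).
Proof.
rewrite /= !sat_big_And /=; split=> [[I0 I1] i|It].
  have [iI|iI] := boolP (i \in I); first by split=> // _; apply: I0.
  by split=> // i0; case: (I1 i iI).
by split=> i; rewrite -?(rwP negP) It.
Qed.

(** The part common to both theories: quantified variables become a tuple [y], while [S] and [R] are
    the readings of the conditions on the permutation and of the conclusion. *)
Lemma sat_ec_sentence n (starred : 'I_n -> formula U) (body : formula U)
    (S : ('I_n -> M) -> 'I_n -> Prop) (R : ('I_n -> M) -> M -> Prop) v :
  (forall w i, sat w (starred i) <-> S (fun k => w k) i) ->
  (forall w x, sat (update w n x) body <-> R (fun k => w k) x) ->
  sat v (Alls (iota 0 n) (Imp (ec_premise starred) (Ex n body))) <->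
  (forall y : 'I_n -> M,
    (forall i, y i <> zero M) -> \big[@join U M/zero M]_i y i = one M ->
    (forall i j, i != j -> meet (y i) (y j) = zero M) ->
    (forall i, S y i) -> exists x, R y x).
Proof.
move=> sS sR; rewrite sat_Alls.
have premise w : sat w (ec_premise starred) <->
    [/\ forall i : 'I_n, w i <> zero M,
        \big[@join U M/zero M]_(i < n) w i = one M,
        forall i j : 'I_n, i != j -> meet (w i) (w j) = zero M
      & forall i, S (fun k => w k) i].
  rewrite /ec_premise !sat_And !sat_big_And /= eval_big_Join /=; split.
    case=> y0 [yU [yI ys]]; split=> // [i|i j ij|i]; first exact: y0.
      exact: (yI (i, j)).
    by apply/sS/ys.
  case=> y0 yU yI ys; split; first by move=> i _; apply: y0.
  split=> //; split; first by case=> i j; apply: yI.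
  by move=> i _; apply/sS.
have ImpE w : sat w (Imp (ec_premise starred) (Ex n body)) =
    (sat w (ec_premise starred) -> exists x, sat (update w n x) body) by [].
split=> [vA y y0 yU yI ys|yA w wv]; last first.
  rewrite ImpE => /premise[w0 wU wI ws].
  by have [x /sR xR] := yA _ w0 wU wI ws; exists x.
(* The tuple is extended to a valuation by [v] outside the ordinal. *)
pose w k := if insub k is Some i then y i else v k.
have wy : (fun k : 'I_n => w k) = y by apply: funext => k; rewrite /w valK.
have wE (k : 'I_n) : w k = y k by rewrite -wy.
move: (vA w); rewrite ImpE premise => -[||x /sR].
- move=> k; rewrite mem_iota add0n /= => kn.
  by rewrite /w insubN.
- split=> [i||i j|i]; rewrite ?wE ?wy //; last exact: yI.
  by under eq_bigr do rewrite wE.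
by rewrite wy; exists x.
Qed.

End Semantics.

(** * Invariance under isomorphism *)

Section Isomorphism.

Variable U : Type.
Implicit Types M N P : structure U.

Lemma is_iso_comp M N P (f : M -> N) (g : N -> P) :
  is_iso f -> is_iso g -> is_iso (g \o f).
Proof.
move=> [bf [f0 f1] fU fI fo] [bg [g0 g1] gU gI go]; split=> /=.
- exact: bij_comp.
- by rewrite f0 f1.
- by move=> x y /=; rewrite fU gU.
- by move=> x y /=; rewrite fI gI.
- by move=> u x /=; rewrite fo go.
Qed.

Lemma isomorphic_trans M N P :
  isomorphic M N -> isomorphic N P -> isomorphic M P.
Proof. by move=> [f fP] [g gP]; exists (g \o f); apply: is_iso_comp. Qed.

Lemma isomorphic_sym M N : isomorphic M N -> isomorphic N M.
Proof.
move=> [f [[g fK gK] [f0 f1] fU fI fo]]; exists g; split.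
- by exists f.
- by rewrite -f0 -f1 !fK.
- by move=> x y; rewrite -{1}(gK x) -{1}(gK y) -fU fK.
- by move=> x y; rewrite -{1}(gK x) -{1}(gK y) -fI fK.
- by move=> u x; rewrite -{1}(gK x) -fo fK.
Qed.

(** By induction on the formula: injectivity of [f] settles equations and surjectivity settles
    quantifiers. *)
Lemma sat_iso M N (f : M -> N) A v :
  is_iso f -> sat v A <-> sat (f \o v) A.
Proof.
move=> [[g fK gK] [f0 f1] fU fI fo].
have evalf t w : f (eval w t) = eval (f \o w) t.
  by elim: t => //= [s <- t <-|s <- t <-|u t <-];
    rewrite (fU, fI, fo).
have updf w i a : f \o update w i a = update (f \o w) i (f a).
  by apply: funext => k; rewrite /= /update; case: ifP.
elim: A v => [|s t|A IHA|A IHA B IHB|A IHA B IHB|i A IHA|i A IHA] v //=.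
- by rewrite -!evalf; split=> [->|/(can_inj fK)].
- by rewrite IHA.
- by rewrite IHA IHB.
- by rewrite IHA IHB.
- split=> vA a; last by apply/IHA; rewrite updf.
  by rewrite -(gK a) -updf; apply/IHA.
- split=> -[a aA]; first by exists (f a); rewrite -updf; apply/IHA.
  by exists (g a); apply/IHA; rewrite updf gK.
Qed.

Lemma models_iso M N (T : theory U) :
  isomorphic M N -> models M T -> models N T.
Proof.
move=> [f fP] MT A TA v; have [[g fK gK] _ _ _ _] := fP.
have -> : v = f \o (g \o v) by apply: funext => k; rewrite /= gK.
by apply/(sat_iso _ _ fP)/MT.
Qed.

Lemma at_most_countable_iso M N :
  isomorphic M N -> at_most_countable M -> at_most_countable N.
Proof.
move=> [f [[g fK gK] _ _ _ _]] [h hI].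
by exists (h \o g); apply: inj_comp => //; apply: can_inj gK.
Qed.

End Isomorphism.

(** * Models as Boolean algebras with an involution *)

Section InvolutionStructure.

Variables (U : Type) (symb : U -> bda_symbol).
Variables (d : Order.disp_t) (T : ctbDistrLatticeType d) (star : T -> T).

(** The map [symb] assigns to each symbol its role, so that one construction serves both languages;
    [bar] is recovered as the complement of [star]. *)
Definition involution_structure : structure U :=
  @Structure U T \bot \top Order.join Order.meet
    (fun u x => if symb u is bda_compl then ~` x else ~` star x).

Lemma lattice_involution_structure :
  \bot <> \top :> T ->
  models involution_structure (@bounded_distributive_lattice U).
Proof.
move=> nt _ [] v.
- by move=> x y; apply: joinC.
- by move=> x y; apply: meetC.
- by move=> x y z; apply: joinA.
- by move=> x y z; apply: meetA.
- by move=> x y; apply: meetKU.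
- by move=> x y; apply: joinKI.
- by move=> x y z; apply: meetUr.
- by move=> x; apply: joinx0.
- by move=> x; apply: meetx1.
- by [].
Qed.

Lemma de_morgan_involution_structure bar :
  is_involution star -> \bot <> \top :> T -> symb bar = bda_bar ->
  models involution_structure (de_morgan_algebra bar).
Proof.
move=> [starK starI starC] nt symb_bar _ [A HA v|v|v].
- exact: lattice_involution_structure.
- by move=> x; rewrite /= symb_bar starC starK complK.
- move=> x y; rewrite /= symb_bar -complU; congr (~` _).
  exact: star_join.
Qed.

End InvolutionStructure.

(** * The axioms read in an algebra with involution *)

Section InvolutionModels.

Variables (d : Order.disp_t) (T : ctbDistrLatticeType d) (star : T -> T).
Hypotheses (starP : is_involution star) (nt : \bot <> \top :> T).

Local Notation bda := (involution_structure (@id bda_symbol) star).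
Local Notation da := (involution_structure (fun _ : da_symbol => bda_bar) star).

(** Uniqueness of complements, by which the auxiliary [z] in the axioms of [ECDA] is determined. *)
Lemma join_meet_compl (x z : T) : x `|` z = \top /\ x `&` z = \bot <-> z = ~` x.
Proof.
split=> [[xz1 xz0]|->]; last by rewrite joinxC meetxC.
by rewrite -[LHS]meet1x -(joinxC x) meetUl xz0 join0x -[RHS]meetx1 -xz1
  meetUr meetCx join0x.
Qed.

Lemma update_ord (M : Type) (w : nat -> M) n k x (i : 'I_n) :
  (n <= k)%N -> update w k x i = w i.
Proof. by move=> nk; rewrite /update ltn_eqF // (leq_trans _ nk). Qed.

Lemma sat_update_zero_pattern U (M : structure U) n (I : {set 'I_n}) t w x :
  sat (update w n x) (zero_pattern I t) <->
  (forall i, i \in I <-> meet (w i) (eval (update w n x) t) = zero M).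
Proof.
by rewrite sat_zero_pattern; split=> H i; move: (H i); rewrite update_ord.
Qed.

Lemma sat_update2_zero_pattern U (M : structure U) n (I : {set 'I_n}) t w x z :
  sat (update (update w n x) n.+1 z) (zero_pattern I t) <->
  (forall i, i \in I <->
     meet (w i) (eval (update (update w n x) n.+1 z) t) = zero M).
Proof.
by rewrite sat_zero_pattern; split=> H i; move: (H i); rewrite !update_ord.
Qed.

Lemma update_eq (M : Type) (w : nat -> M) n x : update w n x n = x.
Proof. by rewrite /update eqxx. Qed.

Lemma update_succ (M : Type) (w : nat -> M) n x z :
  update (update w n x) n.+1 z n = x.
Proof. by rewrite /update ltn_eqF // eqxx. Qed.

Lemma sat_ecbda_sentence n (s : 'S_n) (I1 I2 I3 : {set 'I_n}) (v : nat -> bda) :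
  sat v (ecbda_sentence s I1 I2 I3) <->
  (forall y : 'I_n -> T,
    (forall i, y i <> \bot) -> \join_i y i = \top ->
    (forall i j, i != j -> y i `&` y j = \bot) ->
    (forall i, star (y i) = y (s i)) ->
  exists x, forall i,
    [/\ i \in I1 <-> y i `&` (x `&` ~` star x) = \bot,
        i \in I2 <-> y i `&` (x `&` star x) = \bot
      & i \in I3 <-> y i `&` (~` x `&` ~` star x) = \bot]).
Proof.
apply: (@sat_ec_sentence _ bda n _ _ (fun y i => star (y i) = y (s i))
  (fun y x => forall i,
    [/\ i \in I1 <-> y i `&` (x `&` ~` star x) = \bot,
        i \in I2 <-> y i `&` (x `&` star x) = \bot
      & i \in I3 <-> y i `&` (~` x `&` ~` star x) = \bot])).
  by move=> w i; rewrite /= complK.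
move=> w x; rewrite /phi; cbv beta zeta.
rewrite sat_And [X in _ /\ X]sat_And !sat_update_zero_pattern.
rewrite /= update_eq complK.
split=> [[P1 [P2 P3]] i|P]; first by split.
by split=> [i|]; [|split=> i]; have [] := P i.
Qed.

Lemma sat_ecda_sentence n (s : 'S_n) (I1 I2 I3 : {set 'I_n}) (v : nat -> da) :
  sat v (ecda_sentence s I1 I2 I3) <->
  (forall y : 'I_n -> T,
    (forall i, y i <> \bot) -> \join_i y i = \top ->
    (forall i j, i != j -> y i `&` y j = \bot) ->
    (forall i, star (y i) = y (s i)) ->
  exists x, forall i,
    [/\ i \in I1 <-> y i `&` (x `&` ~` star x) = \bot,
        i \in I2 <-> y i `&` (x `&` star x) = \bot
      & i \in I3 <-> y i `&` (~` x `&` ~` star x) = \bot]).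
Proof.
apply: (@sat_ec_sentence _ da n _ _ (fun y i => star (y i) = y (s i))
  (fun y x => forall i,
    [/\ i \in I1 <-> y i `&` (x `&` ~` star x) = \bot,
        i \in I2 <-> y i `&` (x `&` star x) = \bot
      & i \in I3 <-> y i `&` (~` x `&` ~` star x) = \bot])).
  (* The hypothesis of [ECDA] makes [y (s i)] the complement of [bar (y i)], which is
     [star (y i)]. *)
  by move=> w i; rewrite /= join_meet_compl complK; split.
move=> w x.
(* Here [z] is the complement of [bar x], that is [star x]. *)
have xiE : sat (update w n x) (tilde_xi I2) <->
    forall i : 'I_n, i \in I2 <-> w i `&` (x `&` star x) = \bot.
  have E z : sat (update (update w n x) n.+1 z : nat -> da)
      (And (Eq (Join (Un da_bar (Var n)) (Var n.+1)) One)
        (And (Eq (Meet (Un da_bar (Var n)) (Var n.+1)) Zero)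
           (zero_pattern I2 (Meet (Var n) (Var n.+1))))) <->
    z = star x /\ forall i : 'I_n, i \in I2 <-> w i `&` (x `&` z) = \bot.
    rewrite sat_And [X in _ /\ X]sat_And sat_update2_zero_pattern.
    rewrite /= update_eq update_succ.
    by have := join_meet_compl (~` star x) z; rewrite complK; tauto.
  split=> [[z /E[-> //]]|xP].
  by exists (star x); apply/E.
(* Here [z] is the complement of [x]. *)
have chiE : sat (update w n x) (tilde_chi I3) <->
    forall i : 'I_n, i \in I3 <-> w i `&` (~` x `&` ~` star x) = \bot.
  have E z : sat (update (update w n x) n.+1 z : nat -> da)
      (And (Eq (Join (Var n) (Var n.+1)) One)
        (And (Eq (Meet (Var n) (Var n.+1)) Zero)
           (zero_pattern I3 (Meet (Var n.+1) (Un da_bar (Var n)))))) <->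
    z = ~` x /\ forall i : 'I_n, i \in I3 <-> w i `&` (z `&` ~` star x) = \bot.
    rewrite sat_And [X in _ /\ X]sat_And sat_update2_zero_pattern.
    rewrite /= update_eq update_succ.
    by have := join_meet_compl x z; tauto.
  split=> [[z /E[-> //]]|xP].
  by exists (~` x); apply/E.
rewrite sat_And [X in _ /\ X]sat_And sat_update_zero_pattern xiE chiE.
rewrite /= update_eq.
split=> [[P1 [P2 P3]] i|P]; first by split.
by split=> [i|]; [|split=> i]; have [] := P i.
Qed.

Lemma models_ECBDA : models bda ECBDA <-> extension_property star.
Proof.
split=> [bdaP n s I1 I2 I3 n0 s2 cons|starE].
  by move/sat_ecbda_sentence: (bdaP _ (ECBDA_ec n0 s2 cons) (fun=> \bot)).
move=> _ [A [B [C LC|v|v]|B]|n s I1 I2 I3 n0 s2 cons v].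
- exact: lattice_involution_structure.
- by move=> x; apply: meetxC.
- by move=> x; apply: joinxC.
- exact: de_morgan_involution_structure.
- by apply/sat_ecbda_sentence/starE.
Qed.

Lemma models_ECDA : models da ECDA <-> extension_property star.
Proof.
split=> [daP n s I1 I2 I3 n0 s2 cons|starE].
  by move/sat_ecda_sentence: (daP _ (ECDA_ec n0 s2 cons) (fun=> \bot)).
move=> _ [A [B|v]|n s I1 I2 I3 n0 s2 cons v].
- exact: de_morgan_involution_structure.
- by move=> x; exists (~` x); split; [apply: meetxC | apply: joinxC].
- by apply/sat_ecda_sentence/starE.
Qed.

End InvolutionModels.

(** * Representation of models and uniqueness *)

Lemma de_morgan_is_involution d (T : ctbDistrLatticeType d) (bar : T -> T) :
  involutive bar -> {morph bar : x y / x `|` y >-> x `&` y} ->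
  is_involution (fun x => ~` bar x).
Proof.
move=> barK barU.
have barI x y : bar (x `&` y) = bar x `|` bar y.
  by apply: (inv_inj barK); rewrite barU !barK.
have bar1 : bar \top = \bot.
  by have := barU \top (bar \bot); rewrite join1x barK meetx0.
(* Since [bar] exchanges joins with meets and [\bot] with [\top], it sends complements to
   complements. *)
have barC x : bar (~` x) = ~` bar x.
  apply/join_meet_compl; split; rewrite -?barU -?barI ?joinxC ?meetxC //.
  by rewrite -bar1 barK.
split=> [x|x y|x]; first by rewrite barC complK barK.
  by rewrite barI complU.
by rewrite barC.
Qed.

(** The carrier stays the same and the isomorphism is the identity. The complement is a parameter
    because in [ECDA] it is not a symbol of the language. *)
Lemma boolean_representation U (symb : U -> bda_symbol) (M : structure U)
    (compl bar : M -> M) :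
  models M (@bounded_distributive_lattice U) ->
  (forall x, meet x (compl x) = zero M) ->
  (forall x, join x (compl x) = one M) ->
  involutive bar -> {morph bar : x y / join x y >-> meet x y} ->
  (forall u x, unop u x = if symb u is bda_compl then compl x else bar x) ->
  exists (T : ctbDistrLatticeType (Order.Disp tt tt)) (star : T -> T),
    [/\ is_involution star, \bot <> \top :> T
      & isomorphic M (involution_structure symb star)].
Proof.
move=> lat meetC' joinC' barK barU opE; pose v (_ : nat) := zero M.
pose m := @BooleanOps M (zero M) (one M) (@join U M) (@meet U M) compl
  (lat _ (JoinC U) v) (lat _ (MeetC U) v)
  (lat _ (JoinA U) v) (lat _ (MeetA U) v)
  (lat _ (JoinK U) v) (lat _ (MeetK U) v) (lat _ (MeetJoinD U) v)
  (lat _ (Join0 U) v) (lat _ (Meet1 U) v) meetC' joinC'.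
pose T : ctbDistrLatticeType (Order.Disp tt tt) := boolean_sort m.
exists T, (fun x : T => ~` (bar x : T)); split.
- exact: (@de_morgan_is_involution _ T).
- exact: (lat _ (ZeroNeqOne U) v).
exists (id : M -> T); split=> //; first by exists id.
move=> u x; rewrite opE /=; case: (symb u) => //.
by rewrite complK.
Qed.

Lemma ECBDA_representation (M : structure bda_symbol) :
  models M ECBDA ->
  exists (T : ctbDistrLatticeType (Order.Disp tt tt)) (star : T -> T),
    [/\ is_involution star, \bot <> \top :> T
      & isomorphic M (involution_structure id star)].
Proof.
move=> MT; pose v (_ : nat) := zero M.
have bdaP A : boole_de_morgan_algebra A -> forall v : nat -> M, sat v A.
  by move=> HA; apply/MT/ECBDA_bda.
apply: (@boolean_representation _ id M (unop bda_compl) (unop bda_bar)).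
- by move=> A HA; apply/bdaP/BDA_boolean/Boolean_lattice.
- exact: (bdaP _ (BDA_boolean (MeetCompl _)) v).
- exact: (bdaP _ (BDA_boolean (JoinCompl _)) v).
- exact: (bdaP _ (BDA_de_morgan (BarK _)) v).
- exact: (bdaP _ (BDA_de_morgan (BarJoin _)) v).
- by case.
Qed.

Lemma ECDA_representation (M : structure da_symbol) :
  models M ECDA ->
  exists (T : ctbDistrLatticeType (Order.Disp tt tt)) (star : T -> T),
    [/\ is_involution star, \bot <> \top :> T
      & isomorphic M (involution_structure (fun=> bda_bar) star)].
Proof.
move=> MT; pose v (_ : nat) := zero M.
have daP A : complemented_de_morgan_algebra da_bar A ->
    forall v : nat -> M, sat v A.
  by move=> HA; apply/MT/ECDA_da.
(* The axiom only asserts that complements exist; a function is obtained by choice. *)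
have [compl complP] := choice (daP _ (Complemented _) v).
apply: (@boolean_representation _ (fun=> bda_bar) M compl (unop da_bar)).
- by move=> A HA; apply/daP/Complemented_de_morgan/DeMorgan_lattice.
- by move=> x; case: (complP x).
- by move=> x; case: (complP x).
- exact: (daP _ (Complemented_de_morgan (BarK _)) v).
- exact: (daP _ (Complemented_de_morgan (BarJoin _)) v).
- by case.
Qed.

Lemma involution_structure_unique U (symb : U -> bda_symbol) d1 d2
    (T1 : ctbDistrLatticeType d1) (T2 : ctbDistrLatticeType d2)
    (star1 : T1 -> T1) (star2 : T2 -> T2) :
  is_involution star1 -> is_involution star2 ->
  \bot <> \top :> T1 -> \bot <> \top :> T2 ->
  extension_property star1 -> extension_property star2 ->
  at_most_countable T1 -> at_most_countable T2 ->
  isomorphic (involution_structure symb star1)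
    (involution_structure symb star2).
Proof.
move=> i1 i2 nt1 nt2 e1 e2 [f1 f1_inj] [f2 f2_inj].
have [f [f_bij fI fC fs]] := back_and_forth i1 i2 e1 e2 nt1 nt2 f1_inj f2_inj.
(* Meets and complements determine the rest: [\bot] as the meet of an element and its complement,
   then [\top] and joins by duality. *)
have f0 : f \bot = \bot by rewrite -(meetxC (\bot : T1)) fI fC meetxC.
exists f; split=> //=.
- by rewrite -compl0 fC f0 compl0.
- by move=> x y /=; apply: compl_inj; rewrite complU -!fC -fI complU.
- by move=> u x /=; case: (symb u); rewrite fC ?fs.
Qed.

(** Uniqueness is shown for all at most countable models, and the infinite algebra [B] gives
    existence, so both readings of countable are settled together. *)
Lemma categorical_theory U (symb : U -> bda_symbol) (T : theory U)
    (B : ctbDistrLatticeType (Order.Disp tt tt)) (bstar : B -> B) :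
  (forall M, models M T ->
     exists (L : ctbDistrLatticeType (Order.Disp tt tt)) (star : L -> L),
     [/\ is_involution star, \bot <> \top :> L
       & isomorphic M (involution_structure symb star)]) ->
  (forall (L : ctbDistrLatticeType (Order.Disp tt tt)) (star : L -> L),
     is_involution star -> \bot <> \top :> L ->
     models (involution_structure symb star) T <-> extension_property star) ->
  is_involution bstar -> \bot <> \top :> B -> extension_property bstar ->
  countably_infinite B ->
  aleph0_categorical T /\ has_unique_countable_model T.
Proof.
move=> rep modelsP bP b_nt b_ext B_count.
have countW (A : Type) : countably_infinite A -> at_most_countable A.
  by move=> [f [g fK _]]; exists f; apply: can_inj fK.
have unique (M N : structure U) : at_most_countable M -> at_most_countable N ->
    models M T -> models N T -> isomorphic M N.
  move=> Mc Nc MT NT; have [L1 [s1 [i1 nt1 ML1]]] := rep M MT.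
  have [L2 [s2 [i2 nt2 NL2]]] := rep N NT.
  have e1 : extension_property s1 by apply/modelsP/(models_iso ML1).
  have e2 : extension_property s2 by apply/modelsP/(models_iso NL2).
  apply: isomorphic_trans (ML1) _.
  apply: isomorphic_trans (isomorphic_sym NL2).
  apply: involution_structure_unique => //.
  - exact: at_most_countable_iso ML1 Mc.
  - exact: at_most_countable_iso NL2 Nc.
have exB : models (involution_structure symb bstar) T by apply/modelsP.
split; split.
- by exists (involution_structure symb bstar).
- by move=> M N /countW Mc /countW Nc; apply: unique.
- by exists (involution_structure symb bstar); split=> //; apply: countW.
- exact: unique.
Qed.

(** * The algebra of pairs of periodic sets *)

(** The boolean selects one of two copies of [nat]: [f] is a pair of subsets with a common
    period. *)
Definition periodic (f : bool -> nat -> bool) : Prop :=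
  exists2 p, (0 < p)%N & forall b m, f b (m + p)%N = f b m.

Lemma period_mul (f : bool -> nat -> bool) p k :
  (forall b m, f b (m + p)%N = f b m) ->
  forall b m, f b (m + k * p)%N = f b m.
Proof.
by move=> fp b m; elim: k => [|k IHk]; rewrite ?addn0 // mulSnr addnA fp.
Qed.

Lemma common_period (I : finType) (f : I -> bool -> nat -> bool) :
  (forall i, periodic (f i)) ->
  exists2 p, (0 < p)%N & forall i b m, f i b (m + p)%N = f i b m.
Proof.
move=> fper; have /choice[p pP] : forall i, exists p,
    (0 < p)%N /\ forall b m, f i b (m + p)%N = f i b m.
  by move=> i; have [p] := fper i; exists p.
exists (\prod_i p i)%N; first by apply: prodn_gt0 => i; case: (pP i).
move=> i; rewrite (bigD1 i) //= mulnC; apply: period_mul.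
by case: (pP i).
Qed.

Lemma periodic_op2 (op : bool -> bool -> bool) (f g : bool -> nat -> bool) :
  periodic f -> periodic g -> periodic (fun b m => op (f b m) (g b m)).
Proof.
move=> fper gper; pose fg (a : bool) := if a then f else g.
have [|p p0 fgp] := @common_period _ fg; first by case.
exists p => // b m; have := fgp true b m; have := fgp false b m.
by rewrite /fg => -> ->.
Qed.

Definition periodic_set : Type := {f : bool -> nat -> bool | periodic f}.

Implicit Types x y : periodic_set.

Lemma periodic_set_ext x y : (forall b m, sval x b m = sval y b m) -> x = y.
Proof.
case: x y => [f fP] [g gP] /= fg.
by apply: eq_exist => /=; apply: funext => b; apply: funext => m.
Qed.

Lemma periodic_cst (a : bool) : periodic (fun _ _ => a).
Proof. by exists 1%N. Qed.

Definition periodic_op (op : bool -> bool -> bool) x y : periodic_set :=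
  exist _ _ (periodic_op2 op (svalP x) (svalP y)).

Lemma periodic_compl x : periodic (fun b m => ~~ sval x b m).
Proof. by have [p p0 xp] := svalP x; exists p => // b m; rewrite xp. Qed.

Lemma periodic_swap x : periodic (fun b m => sval x (~~ b) m).
Proof. by have [p p0 xp] := svalP x; exists p => // b m; rewrite xp. Qed.

(** Kept transparent so that membership in meets, complements and bounds computes. *)
Definition periodic_boolean_ops : boolean_ops periodic_set.
Proof.
apply: (@BooleanOps periodic_set (exist _ _ (periodic_cst false))
  (exist _ _ (periodic_cst true)) (periodic_op orb) (periodic_op andb)
  (fun x => exist _ _ (periodic_compl x))).
- by move=> x y; apply: periodic_set_ext => b m; apply: orbC.
- by move=> x y; apply: periodic_set_ext => b m; apply: andbC.
- by move=> x y z; apply: periodic_set_ext => b m; apply: orbA.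
- by move=> x y z; apply: periodic_set_ext => b m; apply: andbA.
- by move=> x y; apply: periodic_set_ext => b m /=; case: (sval x b m).
- by move=> x y; apply: periodic_set_ext => b m /=; case: (sval x b m).
- by move=> x y z; apply: periodic_set_ext => b m; apply: andb_orr.
- by move=> x; apply: periodic_set_ext => b m; apply: orbF.
- by move=> x; apply: periodic_set_ext => b m; apply: andbT.
- by move=> x; apply: periodic_set_ext => b m; apply: andbN.
- by move=> x; apply: periodic_set_ext => b m; apply: orbN.
Defined.

Definition periodic_algebra : ctbDistrLatticeType (Order.Disp tt tt) :=
  boolean_sort periodic_boolean_ops.

Definition mem_per (x : periodic_algebra) (b : bool) (m : nat) : bool :=
  sval (x : periodic_set) b m.

Definition swap (x : periodic_algebra) : periodic_algebra :=
  exist _ _ (periodic_swap x).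

Implicit Types u v : periodic_algebra.

Lemma mem_per_inj u v : (forall b m, mem_per u b m = mem_per v b m) -> u = v.
Proof. exact: periodic_set_ext. Qed.

Lemma mem_per0 b m : mem_per \bot b m = false. Proof. by []. Qed.

Lemma mem_per1 b m : mem_per \top b m = true. Proof. by []. Qed.

Lemma mem_perI u v b m : mem_per (u `&` v) b m = mem_per u b m && mem_per v b m.
Proof. by []. Qed.

Lemma mem_perC u b m : mem_per (~` u) b m = ~~ mem_per u b m.
Proof. by []. Qed.

Lemma mem_per_swap u b m : mem_per (swap u) b m = mem_per u (~~ b) m.
Proof. by []. Qed.

Lemma mem_per_joins (I : finType) (F : I -> periodic_algebra) b m :
  mem_per (\join_i F i) b m = [exists i, mem_per (F i) b m].
Proof.
rewrite (big_morph (fun u => mem_per u b m) (id1 := false) (op1 := orb)) //.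
by rewrite big_orE.
Qed.

Lemma per_eq0 u : u = \bot <-> forall b m, ~~ mem_per u b m.
Proof.
split=> [->|u0] //; apply: mem_per_inj => b m.
by rewrite mem_per0; apply/negbTE.
Qed.

Lemma per_neq0 u : u <> \bot -> exists b m, mem_per u b m.
Proof.
move=> u0; apply: contrapT => no_mem; apply/u0/per_eq0 => b m.
by apply/negP => ubm; apply: no_mem; exists b, m.
Qed.

Lemma swap_involution : is_involution swap.
Proof.
split=> [u|u v|u]; apply: mem_per_inj => b m;
  by rewrite ?(mem_per_swap, mem_perI, mem_perC) ?negbK.
Qed.

Lemma periodic_algebra_nontrivial : \bot <> \top :> periodic_algebra.
Proof. by move=> /(congr1 (fun u => mem_per u true 0)). Qed.

(** At each point of the first copy the values of [x] and [swap x] are chosen among the pairs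
    allowed for its block, and every allowed pair is made to occur. The second copy is then
    determined. *)
Lemma swap_extension : extension_property swap.
Proof.
move=> n s I1 I2 I3 _ s2 [sI2 sI3 I123] y y0 yU yI ys.
have sK i : s (s i) = i by rewrite -permM -expg2 s2 perm1.
have I2s i : (s i \in I2) = (i \in I2).
  by rewrite -{1}sI2 (mem_imset _ _ perm_inj).
have I3s i : (s i \in I3) = (i \in I3).
  by rewrite -{1}sI3 (mem_imset _ _ perm_inj).
(* Whether block [i] must have a nonzero piece with the given values of [x] and [swap x]; the piece
   with values false, true is the swap of one of block [s i]. *)
pose allowed i (c : bool * bool) := match c with
  | (true, false) => i \notin I1 | (false, true) => s i \notin I1
  | (true, true) => i \notin I2 | (false, false) => i \notin I3 end.
have allowed_swap i c d : allowed (s i) (c, d) = allowed i (d, c).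
  by case: c d => [] []; rewrite /allowed ?sK ?I2s ?I3s.
(* A fallback pair for points whose code is not allowed. If block [i] allowed none, [s i] would lie
   in the three sets and in the image of their intersection, against consistency. *)
have /choice[dflt dfltP] i : exists c, allowed i c.
  apply: contrapT => no_allowed.
  have no c : ~~ allowed i c by apply/negP => ic; apply: no_allowed; exists c.
  have := no (true, false); have := no (false, true).
  have := no (true, true); have := no (false, false).
  rewrite /allowed !negbK => i3 i2 si1 i1.
  have /setP/(_ (s i)) := I123; rewrite !inE si1 I2s I3s i2 i3 /=.
  by rewrite imset_f // !inE i1 i2 i3.
have ysE i b m : mem_per (y (s i)) b m = mem_per (y i) (~~ b) m.
  by rewrite -ys mem_per_swap.
have /choice[idx idxP] m : exists i, mem_per (y i) false m.
  apply/existsP; rewrite -mem_per_joins yU.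
  exact: mem_per1.
have idx_eq i m : mem_per (y i) false m -> idx m = i.
  move=> ym; apply: contrapT => /eqP /yI /per_eq0 /(_ false m).
  by rewrite mem_perI idxP ym.
have [p p_gt0 yp] := common_period (fun i => svalP (y i)).
(* The values of x and star x at (false, m) are the two low bits of m %/ p when
   the block of (false, m) allows them: every block meets all residues. *)
pose code m := (odd (m %/ p), odd (m %/ p)./2).
pose c m := if allowed (idx m) (code m) then code m else dflt (idx m).
have cP m : allowed (idx m) (c m) by rewrite /c; case: ifP.
(* The code depends only on [m %/ p] modulo 4 and the block of a point has period [p], whence the
   period [4 * p]. *)
have c_period m : c (m + 4 * p)%N = c m.
  have -> : c (m + 4 * p)%N = if allowed (idx m) (code (m + 4 * p)%N)
      then code (m + 4 * p)%N else dflt (idx m).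
    rewrite /c (idx_eq (idx m)) // /mem_per.
    by rewrite (period_mul 4 (yp (idx m))); apply: idxP.
  rewrite /c; suff -> : code (m + 4 * p)%N = code m by [].
  by rewrite /code addnC divnMDl // addnC addn4 /= !negbK.
(* The value of [swap x] at a point of the first copy is that of [x] at its twin in the second. *)
pose xf (b : bool) m := if b then (c m).2 else (c m).1.
have xf_per : periodic xf.
  by exists (4 * p)%N => [|b m]; rewrite ?muln_gt0 // /xf c_period.
pose x : periodic_algebra := exist _ _ xf_per.
have memx b m : mem_per x b m = xf b m by [].
have xP i b m : mem_per (y i) b m -> allowed i (xf b m, xf (~~ b) m).
  case: b => [|/idx_eq <-]; last first.
    by rewrite -[(_, _)]/((c m).1, (c m).2) -surjective_pairing.
  rewrite -[true]/(~~ false) -ysE => /idx_eq im.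
  rewrite -[(_, _)]/((c m).2, (c m).1).
  by rewrite -allowed_swap -im -surjective_pairing.
have xI i d : allowed i d ->
    exists b m, mem_per (y i) b m /\ (xf b m, xf (~~ b) m) = d.
  case: d => d e ide; have [b [m0 ym0]] := per_neq0 (y0 i).
  (* On the second copy [x] and [swap x] exchange their values. *)
  pose d' := if b then (e, d) else (d, e).
  (* This point has the residue of [m0] modulo [p], hence lies in the same block, and its quotient
     by [p] has the bits [d']. *)
  pose m := (m0 %% p + (d'.1 + d'.2.*2) * p)%N.
  have ym : mem_per (y i) b m.
    rewrite /mem_per /m (period_mul _ (yp i)) -(period_mul (m0 %/ p) (yp i)).
    by rewrite addnC -divn_eq.
  have code_m : code m = d'.
    rewrite /code /m addnC divnMDl // divn_small ?ltn_mod // addn0.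
    by rewrite half_bit_double oddD odd_double addbF !oddb; case: (d').
  exists b, m; split=> //; rewrite /xf.
  case: b @d' ym0 @m ym code_m => d' ym0 m ym code_m.
    have idxm : idx m = s i by apply: idx_eq; rewrite ysE.
    by rewrite /c code_m idxm allowed_swap ide.
  by rewrite /c code_m (idx_eq i) // ide.
have zeroP i (t : periodic_algebra) d :
    (forall b m, mem_per t b m = ((xf b m, xf (~~ b) m) == d)) ->
    ~~ allowed i d <-> y i `&` t = \bot.
  move=> tE; rewrite per_eq0; split=> [nd b m|yt0].
    rewrite mem_perI tE; apply/negP => /andP[ym /eqP xd].
    by have := xP i b m ym; rewrite xd (negPf nd).
  apply/negP => /xI[b [m [ym xd]]].
  by have := yt0 b m; rewrite mem_perI tE ym xd eqxx.
exists x => i; split.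
- have := zeroP i (x `&` ~` swap x) (true, false); rewrite /allowed negbK.
  apply=> b m.
  by rewrite mem_perI mem_perC mem_per_swap !memx xpair_eqE eqb_id eqbF_neg.
- have := zeroP i (x `&` swap x) (true, true); rewrite /allowed negbK.
  apply=> b m.
  by rewrite mem_perI mem_per_swap !memx xpair_eqE !eqb_id.
- have := zeroP i (~` x `&` ~` swap x) (false, false); rewrite /allowed negbK.
  apply=> b m.
  by rewrite mem_perI !mem_perC mem_per_swap !memx xpair_eqE !eqbF_neg.
Qed.

(** * Countability of the algebra *)

Local Open Scope card_scope.

Lemma countably_infinite_inj (T : Type) (f : T -> nat) (g : nat -> T) :
  injective f -> injective g -> countably_infinite T.
Proof.
move=> f_inj g_inj.
have inj_le (A B : Type) (h : A -> B) : injective h -> [set: A] #<= [set: B].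
  move=> h_inj; have [k] : $|{injfun [set: A] >-> [set: B]}|.
    by apply/injfunPex; exists h => // a b _ _; apply: h_inj.
  exact: inj_card_le.
have /pcard_eqP[h] : [set: T] #= [set: nat].
  by apply: Cantor_Bernstein; [apply: inj_le f_inj | apply: inj_le g_inj].
by exists h; apply: bijTT.
Qed.

Lemma periodic_set_inj : exists f : periodic_set -> nat, injective f.
Proof.
have /choice[p pP] : forall x : periodic_set, exists p,
    (0 < p)%N /\ forall b m, sval x b (m + p)%N = sval x b m.
  by move=> x; have [p] := svalP x; exists p.
(* A periodic set is determined by a period and its values over one period in each copy. *)
exists (fun x => pickle (p x, [seq sval x false m | m <- iota 0 (p x)],
  [seq sval x true m | m <- iota 0 (p x)])).
move=> x y /(pcan_inj pickleK)[pxy].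
rewrite -pxy => /eq_in_map ff /eq_in_map tt.
apply: periodic_set_ext => b m.
have [p0 xp] := pP x; have [_ yp] := pP y; rewrite -pxy in yp.
rewrite (divn_eq m (p x)) addnC (period_mul _ xp) (period_mul _ yp).
have m_in : (m %% p x)%N \in iota 0 (p x) by rewrite mem_iota add0n ltn_mod.
by case: b; [apply: tt | apply: ff].
Qed.

(** The sets of multiples, pairwise distinct because divisibility is antisymmetric, show that the
    algebra is infinite. *)
Lemma periodic_multiples k : periodic (fun _ m => k.+1 %| m)%N.
Proof. by exists k.+1 => // _ m; rewrite dvdn_addl. Qed.

Lemma periodic_algebra_countable : countably_infinite periodic_algebra.
Proof.
have [f f_inj] := periodic_set_inj.
apply: (countably_infinite_inj f_inj
  (g := fun k => exist _ _ (periodic_multiples k))).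
move=> k l /(congr1 sval) /= kl.
have E m : (k.+1 %| m)%N = (l.+1 %| m)%N.
  exact: (congr1 (fun h => h false m) kl).
by apply/succn_inj/eqP; rewrite eqn_dvd E dvdnn -E dvdnn.
Qed.

Theorem theorem6p1 :
  (aleph0_categorical ECBDA /\ has_unique_countable_model ECBDA) /\
  (aleph0_categorical ECDA /\ has_unique_countable_model ECDA).
Proof.
split.
- apply: (categorical_theory ECBDA_representation) => [L star||||].
  + exact: models_ECBDA.
  + exact: swap_involution.
  + exact: periodic_algebra_nontrivial.
  + exact: swap_extension.
  + exact: periodic_algebra_countable.
- apply: (categorical_theory ECDA_representation) => [L star||||].
  + exact: models_ECDA.
  + exact: swap_involution.
  + exact: periodic_algebra_nontrivial.
  + exact: swap_extension.
  + exact: periodic_algebra_countable.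
Qed.
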